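(* For any $\gamma>1$ and any $\rho,N>0$, there exists a metric space $(X,d)$ with $\gamma$-cover dimension $\dim_\gamma(X)=\Theta_\gamma(\rho)$ such that no deterministic online algorithm can achieve a competitive ratio better than $N$ in the nested ball chasing problem over $X$. In other words, $R(X)\ge\hat R(X)\ge N$.
   Context: Notation $\Theta_\gamma$: the hidden constants depend only on $\gamma$; that is, $\dim_\gamma(X)=\Theta_\gamma(\rho)$ means $c_\gamma\,\rho\le\dim_\gamma(X)\le C_\gamma\,\rho$ with constants $c_\gamma,C_\gamma>0$ depending only on $\gamma$. $\gamma$-cover dimension: for a metric space $(X,d)$ and $E\subseteq X$, let $N_r(E)$ be the smallest number of open balls of $X$ with radius at most $r$ that cover $E$. For $\gamma>1$, the $\gamma$-cover constant is $\lambda_\gamma=\sup_{x\in X,\,R>0}N_{R/\gamma}(B(x,R))$, where $B(x,R)=\{y\in X:d(x,y)<R\}$ is the open ball, and the $\gamma$-cover dimension is $\dim_\gamma(X)=\log_\gamma\lambda_\gamma$. Ball chasing over $(X,d)$: an online player starts at a point $x_0\in X$. At each time $t=1,\dots,T$ ($T\in\mathbb{N}$) a closed ball $B_t=\bar B(z,r)=\{y\in X:d(z,y)\le r\}$, for some $z\in X$, $r\ge0$, is revealed. A deterministic online algorithm $\mathcal{A}$ chooses $x_t\in B_t$ as a function of $x_0,B_1,\dots,B_t$ only. Its cost is $\sum_{t=1}^T d(x_t,x_{t-1})$, and the offline optimum is $\inf\{\sum_{t=1}^T d(y_t,y_{t-1}): y_t\in B_t\ \forall t\ge 1,\ y_0=x_0\}$.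 The competitive ratio $C(\mathcal{A})\in[1,\infty]$ is the supremum of cost divided by offline optimum over all starting points $x_0\in X$, all $T\in\mathbb{N}$, and all request sequences. $R(X)$ is the infimum of $C(\mathcal{A})$ over all deterministic online algorithms. In the nested ball chasing problem only sequences with $B_1\supseteq B_2\supseteq\dots\supseteq B_T$ are allowed, and $\hat R(X)$ is the corresponding infimum of competitive ratios.
   Formalization: The upper bound in dim_γ(X)=Θ_γ(ρ) is proved as C_γ·max(1,ρ) instead of C_γ·ρ: a positive γ-cover dimension is at least log_γ 2, so the literal bound fails as ρ→0; for ρ bounded below in terms of γ it is the literal claim. *)

(* Defs.v *)
From HB Require Import structures.
From mathcomp Require Import all_boot all_order all_algebra.
From mathcomp Require Import all_classical all_reals all_analysis.

Set Implicit Arguments.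
Unset Strict Implicit.
Unset Printing Implicit Defensive.

Import Order.TTheory GRing.Theory Num.Theory.

Local Open Scope classical_set_scope.
Local Open Scope ring_scope.

Section Dimension.
Context {R : realType} (X : metricType R).
Implicit Types (r g : R) (x : X) (E : set X).

(* The value is +oo when no finite cover exists. *)
Definition covering_number r E : \bar R :=
  ereal_inf [set n%:R%:E | n in [set n : nat |
    exists (c : 'I_n -> X) (s : 'I_n -> R),
      (forall i, 0 < s i <= r) /\ E `<=` \bigcup_i ball (c i) (s i)]].

Definition cover_constant g : \bar R :=
  ereal_sup [set l : \bar R |
    exists x r, 0 < r /\ l = covering_number (r / g) (ball x r)].

Definition cover_dim g : \bar R := (lne (cover_constant g) / (ln g)%:E)%E.

(* Covering numbers are integers, so cover dimensions have a gap above 0. In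
   particular c * rho <= cover_dim g <= C * rho cannot hold for all rho > 0
   with c, C > 0 depending on g only: as rho tends to 0, the upper bound has to
   be read as C * max 1 rho. *)
Lemma cover_dim_gap g : 1 < g ->
  (0 < cover_dim g -> (ln 2 / ln g)%:E <= cover_dim g)%E.
Proof.
move=> g1; have lg : 0 < ln g by rewrite ln_gt0.
have -> : cover_dim g = (lne (cover_constant g) * ((ln g)^-1)%:E)%E.
  by rewrite /cover_dim inver gt_eqF.
rewrite pmule_lgt0 ?lte_fin ?invr_gt0// lne_gt0.
move=> /ereal_sup_gt [_ [x [r [r0 ->]]] l1].
have l2 : (2%:E <= cover_constant g)%E.
  apply: (@le_trans _ _ (covering_number (r / g) (ball x r))); last first.
    by apply: ereal_sup_ubound; exists x, r.
  apply: le_ereal_inf_tmp => _ [n En <-]; rewrite lee_fin (ler_nat R 2 n).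
  rewrite -(ltr_nat R 1 n) -lte_fin; apply: (lt_le_trans l1).
  by apply: ereal_inf_lbound; exists n.
rewrite EFinM lee_pmul2r// ?lte_fin ?invr_gt0//.
rewrite -lne_EFin// lee_lne// in_itv/= leey andbT ?lee_fin//.
exact: le_trans l2.
Qed.

End Dimension.

Section BallChasing.
Context {R : realType} (X : metricType R).
Implicit Types (x : X) (B : set X) (s : seq (set X)) (y : nat -> X).

(* Not the library's [closed_ball], which is the closure of an open ball. *)
Definition cball x (r : R) : set X := [set y | mdist x y <= r].

Definition is_cball B := exists x (r : R), 0 <= r /\ B = cball x r.

(* The request B_t is [nth setT s t.-1]. *)
Definition ball_requests s :=
  forall t, (t < size s)%N -> is_cball (nth setT s t).

Definition nested_requests s := ball_requests s /\
  forall t, (t.+1 < size s)%N -> nth setT s t.+1 `<=` nth setT s t.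

Definition move_cost y (T : nat) : R := \sum_(t < T) mdist (y t.+1) (y t).

(* All requests are nonempty, so this is the infimum of a nonempty set of
   nonnegative reals. *)
Definition offline_opt x0 s : R :=
  inf [set c | exists y, [/\ y 0%N = x0,
    forall t, (t < size s)%N -> nth setT s t (y t.+1)
    & c = move_cost y (size s)]].

(* [A x0 [:: B_1; ...; B_t]] is the position x_t chosen when B_t is revealed;
   the value of A on the empty sequence is not used. *)
Definition algorithm := X -> seq (set X) -> X.

Definition feasible (adm : set (seq (set X))) (A : algorithm) :=
  forall x0 s B, adm (rcons s B) -> B (A x0 (rcons s B)).

Definition trajectory (A : algorithm) x0 s (t : nat) : X :=
  if t is 0 then x0 else A x0 (take t s).

Definition online_cost (A : algorithm) x0 s : R :=
  move_cost (trajectory A x0 s) (size s).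

(* 0 / 0 is 1, so that competitive ratios lie in [1, +oo]; the library's
   division already gives c / 0 = +oo for c > 0. *)
Definition cost_ratio (c opt : R) : \bar R :=
  if (c == 0) && (opt == 0) then 1%E else (c%:E / opt%:E)%E.

Definition competitive_ratio (adm : set (seq (set X))) (A : algorithm) :
    \bar R :=
  ereal_sup [set q | exists x0 s, adm s /\
    q = cost_ratio (online_cost A x0 s) (offline_opt x0 s)].

Definition optimal_ratio (adm : set (seq (set X))) : \bar R :=
  ereal_inf [set competitive_ratio adm A | A in feasible adm].

Definition chasing_ratio : \bar R := optimal_ratio ball_requests.

Definition nested_chasing_ratio : \bar R := optimal_ratio nested_requests.

End BallChasing.

(* Main.v *)
Require Import Defs.
From HB Require Import structures.
From mathcomp Require Import all_boot all_order all_algebra.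
From mathcomp Require Import all_classical all_reals all_analysis.
From mathcomp Require Import ring lra.

(* Take the b ^ D leaves of a b-adic ultrametric tree whose level-k distances
   are g ^ k, with b > g of order g ^ max(1, rho). For every set S of leaves add
   a far-away center, slightly closer to the leaves in S than to the others, the
   centers being at mutually different scales. The new points at most double
   covering numbers, so the cover dimension stays between log_g b and
   log_g (2 b), whereas every set of leaves has become the trace of a closed
   ball. Requesting always the leaves not yet visited forces about b ^ D moves
   of length at least 1 (leaving the tree is even more expensive), while the
   offline player goes at once to a surviving leaf, at distance at most g ^ D.
   The ratio (b / g) ^ D is unbounded in D. *)

Set Implicit Arguments.
Unset Strict Implicit.
Unset Printing Implicit Defensive.

Import Order.TTheory GRing.Theory Num.Theory.

Local Open Scope classical_set_scope.
Local Open Scope ring_scope.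

(** * Levels in the b-adic tree on the natural numbers *)

Section Level.
Context (b : nat) (b_gt1 : (1 < b)%N).
Implicit Types i j k : nat.

(** The height of the least common ancestor, [i %/ b ^ k] being the ancestor of [i] at height [k].
    The search may stop at [maxn i j] because [n < b ^ n]. *)
Definition level i j : nat :=
  find (fun k => i %/ b ^ k == j %/ b ^ k)%N (iota 0 (maxn i j).+1).

Lemma level_le i j k : (level i j <= k)%N = (i %/ b ^ k == j %/ b ^ k)%N.
Proof.
have up m n : (m <= n -> i %/ b ^ m == j %/ b ^ m -> i %/ b ^ n == j %/ b ^ n)%N.
  by move=> /subnKC <- /eqP ij; rewrite expnD !divnMA ij.
pose p := fun k => (i %/ b ^ k == j %/ b ^ k)%N.
have hasp : has p (iota 0 (maxn i j).+1).
  apply/hasP; exists (maxn i j); first by rewrite mem_iota add0n leqnn.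
  have lt := ltn_expl (maxn i j) b_gt1.
  by rewrite /p !divn_small// (leq_ltn_trans _ lt)// ?leq_maxl ?leq_maxr.
have lt_size : (level i j < (maxn i j).+1)%N.
  by rewrite -[X in (_ < X)%N](size_iota 0) -has_find.
apply/idP/idP => [lek|pk].
  by apply: (up _ _ lek); have := nth_find 0%N hasp; rewrite nth_iota.
rewrite leqNgt; apply/negP => ltk.
have := before_find 0%N ltk.
by rewrite nth_iota ?pk// (ltn_trans ltk).
Qed.

Lemma level_sym i j : level i j = level j i.
Proof.
apply/eqP; rewrite eqn_leq; apply/andP.
by split; rewrite level_le eq_sym -level_le.
Qed.

Lemma level_eq0 i j : (level i j == 0)%N = (i == j).
Proof. by rewrite -leqn0 level_le expn0 !divn1. Qed.

Lemma level_ultra j i k : (level i k <= maxn (level i j) (level j k))%N.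
Proof.
rewrite level_le; set m := maxn _ _.
have /eqP -> : (i %/ b ^ m == j %/ b ^ m)%N by rewrite -level_le leq_maxl.
by rewrite -level_le leq_maxr.
Qed.

(** At height [m] the quotients are 1 and 0, one step higher both vanish. This evaluates distances
    from a center to leaves and to centers of smaller rank. *)
Lemma level_expl i m : (i < b ^ m)%N -> level (b ^ m) i = m.+1.
Proof.
move=> im; have b0 k : (0 < b ^ k)%N by rewrite expn_gt0 ltnW.
apply/eqP; rewrite eqn_leq level_le ltnNge level_le divnn b0 !divn_small//=.
  by rewrite (ltn_trans im)// ltn_exp2l.
by rewrite ltn_exp2l.
Qed.

Lemma level_small i j D : (i < b ^ D)%N -> (j < b ^ D)%N -> (level i j <= D)%N.
Proof. by move=> iD jD; rewrite level_le !divn_small. Qed.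

End Level.

(** * A numbering of sets monotone for inclusion *)

Section SetRank.
Context (T : finType).
Implicit Types S : {set T}.

(** Cardinality dominates and [enum_rank] breaks ties. Injectivity separates the scales of the
    centers; monotonicity makes the requested balls nested. *)
Definition set_rank S : nat := (#|S| * #|{set T}| + enum_rank S)%N.

Lemma set_rank_inj : injective set_rank.
Proof.
move=> S S' /(congr1 (modn^~ #|{set T}|)).
rewrite /set_rank !modnMDl !modn_small// => /val_inj; exact: enum_rank_inj.
Qed.

Lemma set_rank_mono S S' : S \subset S' -> (set_rank S <= set_rank S')%N.
Proof.
rewrite subEproper => /predU1P[->//|/proper_card lt].
rewrite /set_rank (@leq_trans (#|S|.+1 * #|{set T}|))//.
  by rewrite mulSn addnC leq_add2r ltnW.
by rewrite (leq_trans _ (leq_addr _ _))// leq_mul2r lt orbT.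
Qed.

End SetRank.

(* [inl i] is a leaf, [inr S] the center attached to the set of leaves S. The
   parameter L pushes the centers away from the tree, making it as expensive as
   desired to leave it. *)
Definition trap {R : realType} (g : R) (b D L : nat) (g1 : 1 < g)
  (b1 : (1 < b)%N) : Type := ('I_(b ^ D) + {set 'I_(b ^ D)})%type.

(** * The trap metric *)

Section Trap.
Context {R : realType} (g : R) (b D L : nat) (g1 : 1 < g) (b1 : (1 < b)%N).
Local Notation X := (trap D L g1 b1).
Local Notation Y := 'I_(b ^ D).
Implicit Types (x y z : X) (S : {set Y}) (i : Y).

HB.instance Definition _ := Finite.copy X ('I_(b ^ D) + {set 'I_(b ^ D)})%type.

Definition is_center x : bool := if x is inr _ then true else false.

Definition address x : nat :=
  match x with inl i => i | inr A => (b ^ (D + L + set_rank A))%N end.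

Definition off x y : bool :=
  match x, y with
  | inl i, inr A | inr A, inl i => i \notin A
  | _, _ => false
  end.

Local Notation lev x y := (level b (address x) (address y)).

Definition trap_dist x y : R :=
  if x == y then 0 else g ^+ lev x y + (off x y)%:R.

Lemma g_gt0 : 0 < g. Proof. exact: lt_trans g1. Qed.

Lemma ler_gX m n : (g ^+ m <= g ^+ n) = (m <= n)%N.
Proof. exact: ler_eXn2l. Qed.

Lemma gX_ge1 m : 1 <= g ^+ m. Proof. by rewrite exprn_ege1// ltW. Qed.

Lemma lt_center i S : (i < b ^ (D + L + set_rank S))%N.
Proof.
by rewrite (leq_trans (ltn_ord i))// leq_exp2l// -addnA leq_addr.
Qed.

Lemma address_inj : injective address.
Proof.
move=> [i|S] [j|S'] /=.
- by move=> /val_inj ->.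
- by move=> e; have := lt_center i S'; rewrite e ltnn.
- by move=> e; have := lt_center j S; rewrite e ltnn.
- move=> /eqP; rewrite eqn_exp2l// eqn_add2l => /eqP /set_rank_inj -> //.
Qed.

Lemma offC x y : off x y = off y x. Proof. by case: x y => [?|?] [?|?]. Qed.

Lemma lev_eq0 x y : (lev x y == 0)%N = (x == y).
Proof. by rewrite (level_eq0 b1) (inj_eq address_inj). Qed.

Lemma trap_dist_ge x y : x != y -> g ^+ lev x y <= trap_dist x y.
Proof. by rewrite /trap_dist => /negPf ->; rewrite lerDl ler0n. Qed.

Lemma trap_dist_ge0 x y : 0 <= trap_dist x y.
Proof.
have [->|xy] := eqVneq x y; first by rewrite /trap_dist eqxx.
by rewrite (le_trans _ (trap_dist_ge xy))// exprn_ge0// ltW// g_gt0.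
Qed.

Lemma trap_distxx x : trap_dist x x = 0.
Proof. by rewrite /trap_dist eqxx. Qed.

Lemma trap_dist_eq0 x y : trap_dist x y = 0 -> x = y.
Proof.
move=> d0; apply/eqP; apply: contraT => /trap_dist_ge; rewrite d0 leNgt.
by rewrite exprn_gt0// g_gt0.
Qed.

Lemma trap_dist_sym x y : trap_dist x y = trap_dist y x.
Proof. by rewrite /trap_dist (eq_sym x) (level_sym b1 (address x)) (offC x). Qed.

(* Distances between distinct points are at least 1, so a perturbation of an
   ultrametric by at most 1 is still a metric. *)
Lemma trap_dist_triangle y x z :
  trap_dist x z <= trap_dist x y + trap_dist y z.
Proof.
have [->|xy] := eqVneq x y; first by rewrite trap_distxx add0r.
have [->|yz] := eqVneq y z; first by rewrite trap_distxx addr0.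
have [->|xz] := eqVneq x z; first by rewrite trap_distxx addr_ge0 ?trap_dist_ge0.
rewrite (le_trans _ (lerD (trap_dist_ge xy) (trap_dist_ge yz)))//.
rewrite /trap_dist (negPf xz).
have off1 : (off x z)%:R <= 1 :> R by rewrite lern1 leq_b1.
have := level_ultra b1 (address y) (address x) (address z).
rewrite leq_max -!ler_gX.
move=> /orP[h|h]; first exact: lerD h (le_trans off1 (gX_ge1 _)).
rewrite [leRHS]addrC; exact: lerD h (le_trans off1 (gX_ge1 _)).
Qed.

HB.instance Definition _ := isMetric.Build R X
  trap_distxx trap_dist_eq0 trap_dist_sym trap_dist_triangle.

Lemma trap_mdistE x y : mdist x y = trap_dist x y. Proof. by []. Qed.

Lemma trap_ballE x r : ball x r = [set y | trap_dist x y < r].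
Proof. by rewrite ballEmdist. Qed.

End Trap.

(** * Cover dimension of the trap *)

Section TrapDimension.
Context {R : realType} (g : R) (b D L : nat) (g1 : 1 < g) (b1 : (1 < b)%N).
Local Notation X := (trap D L g1 b1).
Local Notation lev x y := (level b (address x) (address y)).
Implicit Types (x y z : X) (r : R).

(* If k is the largest level occurring in the ball, then g ^+ k < r, and the
   ball meets at most b classes of level k - 1. On the tree part, and on the
   center part, of such a class distances are at most g ^+ (k - 1) < r / g. *)
Lemma trap_covering_le x r : 0 < r ->
  (covering_number (r / g) (ball x r) <= (b * 2)%:R%:E)%E.
Proof.
move=> r0; have g0 := g_gt0 g1.
have rg0 : 0 < r / g by rewrite divr_gt0.
apply: ereal_inf_lbound; exists (b * 2)%N => //=.
pose k := (\max_(y : X | (trap_dist x y < r)%R) lev x y)%N.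
have levk y : trap_dist x y < r -> (lev x y <= k)%N.
  by move=> xy; exact: (@leq_bigmax_cond _ (fun y => trap_dist x y < r) (fun y => lev x y)).
have kr : (0 < k)%N -> g ^+ k < r.
  have [|z xz kz] := @eq_bigmax_cond X (fun y => trap_dist x y < r) (fun y => lev x y).
    by apply/card_gt0P; exists x; rewrite unfold_in trap_distxx.
  rewrite /k kz lt0n lev_eq0 => neq.
  exact: le_lt_trans (trap_dist_ge neq) xz.
pose near_x y := (address y %/ b ^ k == address x %/ b ^ k)%N.
pose digit y := ((address y %/ b ^ k.-1) %% b)%N.
(* The quotient [i %/ 2] selects a class of level [k.-1], the parity of [i] its leaf or center
   part. *)
pose p (i : 'I_(b * 2)) y :=
  [&& near_x y, digit y == i %/ 2 & is_center y == odd i]%N.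
exists (fun i => odflt x [pick y | p i y]), (fun=> r / g).
split=> [i|y]; first by rewrite rg0 lexx.
rewrite trap_ballE/= => xy.
have ny : near_x y by rewrite /near_x eq_sym -(level_le b1) levk.
have lt_idx : (digit y * 2 + is_center y < b * 2)%N.
  rewrite (@leq_trans ((digit y).+1 * 2))//.
    by rewrite mulSn addnC ltn_add2r; case: is_center.
  by rewrite leq_mul2r ltn_mod ltnW.
exists (Ordinal lt_idx) => //; rewrite trap_ballE/=.
case: pickP => [c|/(_ y)]; last first.
  by rewrite /p ny/= divnMDl// divn_small ?addn0 ?eqxx//=; last (by case: is_center);
     rewrite oddD oddM andbF/=; case: is_center.
rewrite /p /= divnMDl// (@divn_small (is_center y)) ?addn0; last by case: is_center.
rewrite oddD oddM andbF/= oddb => /and3P[nc /eqP dc /eqP tc].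
have [->|cy] := eqVneq c y; first by rewrite trap_distxx.
rewrite /trap_dist (negPf cy).
have -> : off c y = false by case: (c) (y) tc => [?|?] [?|?].
(* [k.-1] is a true predecessor: at [k = 0] nearness forces equal addresses, against [c != y]. *)
have k0 : (0 < k)%N.
  rewrite lt0n; apply/negP => /eqP k0; move: nc ny cy.
  rewrite /near_x k0 expn0 !divn1 => /eqP cx /eqP yx.
  by rewrite (address_inj (etrans cx (esym yx))) eqxx.
rewrite addr0 ltr_pdivlMr// -exprSr (le_lt_trans _ (kr k0))// (ler_gX g1).
rewrite -[leqRHS](prednK k0) ltnS (level_le b1).
have split_digit z : (address z %/ b ^ k.-1 = address z %/ b ^ k * b + digit z)%N.
  by rewrite -[in (_ ^ k)%N](prednK k0) expnSr divnMA -divn_eq.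
by rewrite !split_digit dc (eqP nc) (eqP ny).
Qed.

(** Distinct points are at distance at least [g], so an open ball of radius at most [g ^+ 2 / g = g]
    holds only its center, while the large ball holds the first [b] leaves. *)
Lemma trap_covering_ge (i0 : 'I_(b ^ D)) : (0 < D)%N -> i0 = 0%N :> nat ->
  (b%:R%:E <= covering_number (g ^+ 2 / g) (ball (inl i0 : X) (g ^+ 2)))%E.
Proof.
move=> D0 i00; have g0 := g_gt0 g1.
apply: le_ereal_inf_tmp => _ [n [c [s [sg cover]]] <-]; rewrite lee_fin ler_nat.
have bD : (b <= b ^ D)%N by rewrite -[leqLHS]expn1 leq_exp2l.
pose y (j : 'I_b) : X := inl (widen_ord bD j).
have near_y j : ball (inl i0 : X) (g ^+ 2) (y j).
  rewrite trap_ballE/= /trap_dist; case: ifP => _; first by rewrite exprn_gt0.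
  rewrite addr0 ltr_eXn2l// ltnS (level_le b1) expn1 /= i00 !divn_small//.
  by rewrite ltnW.
have /choice[h hy] j : exists i : 'I_n, y j = c i.
  have [i _] := cover _ (near_y j); rewrite trap_ballE/= => lt.
  exists i; apply/eqP; apply: contraT; rewrite eq_sym => neq.
  have := lt_le_trans (le_lt_trans (trap_dist_ge neq) lt) (proj2 (andP (sg i))).
  by rewrite expr2 mulfK ?gt_eqF// -[ltRHS](expr1 g) ltr_eXn2l// ltnS leqn0 lev_eq0 (negPf neq).
rewrite -[b]card_ord -[n]card_ord; apply: (leq_card h) => j j' e.
by have : y j = y j'; [rewrite hy e -hy | case=> /val_inj].
Qed.

Lemma trap_cover_dim_bounds : (0 < D)%N ->
  ((ln b%:R / ln g)%:E <= cover_dim X g <= (ln (b * 2)%:R / ln g)%:E)%E.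
Proof.
move=> D0; have lg : 0 < ln g by rewrite ln_gt0.
have bD0 : (0 < b ^ D)%N by rewrite expn_gt0 ltnW.
have lb : (b%:R%:E <= cover_constant X g)%E.
  apply: le_trans (@trap_covering_ge (Ordinal bD0) D0 erefl) _.
  apply: ereal_sup_ubound; exists (inl (Ordinal bD0)), (g ^+ 2).
  by split=> //; rewrite exprn_gt0// (g_gt0 g1).
have ub : (cover_constant X g <= (b * 2)%:R%:E)%E.
  by apply: ge_ereal_sup => _ [x [r [r0 ->]]]; exact: trap_covering_le.
have b0 : 0 < b%:R :> R by rewrite ltr0n ltnW.
have b20 : 0 < (b * 2)%:R :> R by rewrite ltr0n muln_gt0 ltnW.
have c0 : (0 <= cover_constant X g)%E.
  by apply: le_trans lb; rewrite lee_fin ltW.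
rewrite /cover_dim inver gt_eqF// !EFinM !lee_pmul2r ?lte_fin ?invr_gt0//.
rewrite -!lne_EFin//; apply/andP; split.
  by rewrite lee_lne ?lb// in_itv/= leey andbT ?c0// lee_fin ltW.
by rewrite lee_lne ?ub// in_itv/= leey andbT ?c0// lee_fin ltW.
Qed.

End TrapDimension.

(** * Comparison of competitive ratios *)

Lemma nested_le_chasing {R : realType} (X : metricType R) :
  (nested_chasing_ratio X <= chasing_ratio X)%E.
Proof.
apply: le_ereal_inf_tmp => _ [A feasA <-].
have nested_ball : @nested_requests R X `<=` @ball_requests R X by move=> s [].
apply: (@le_trans _ _ (competitive_ratio (@nested_requests R X) A)).
  apply: ereal_inf_lbound; exists A => // x s B /nested_ball; exact: feasA.
by apply: ereal_sup_le => _ [x [s [/nested_ball adm ->]]]; exists x, s.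
Qed.

(** Positivity of [c] excludes the 0 / 0 convention, and [q = 0] then gives [+oo]. *)
Lemma le_cost_ratio {R : realType} (N M c q : R) : 0 < N -> 0 < M ->
  0 <= q <= M -> N * M <= c -> (N%:E <= cost_ratio c q)%E.
Proof.
move=> N0 M0 /andP[q0 qM] NMc.
have c0 : 0 < c by rewrite (lt_le_trans _ NMc) ?mulr_gt0.
rewrite /cost_ratio gt_eqF//= inver; case: eqP => [_|/eqP q_neq0].
  by rewrite gt0_muley ?leey// lte_fin.
have {q_neq0}q_gt0 : 0 < q by rewrite lt_neqAle eq_sym q_neq0.
rewrite lee_pdivlMr// lee_fin (le_trans _ NMc)// ler_wpM2l// ltW//.
Qed.

(** * The adversary on the trap *)

Section Trapping.
Context {R : realType} (g : R) (b D L : nat) (g1 : 1 < g) (b1 : (1 < b)%N).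
Local Notation X := (trap D L g1 b1).
Local Notation Y := 'I_(b ^ D).
Local Notation lev x y := (level b (address x) (address y)).
Implicit Types (x y z : X) (S : {set Y}) (i : Y).

(** The radius is the distance from the center to the leaves in [S]; the other leaves are farther by
    exactly 1. *)
Definition trap_ball S : set X :=
  cball (inr S : X) (g ^+ (D + L + set_rank S).+1).

Lemma trap_ball_inl S i : trap_ball S (inl i) <-> i \in S.
Proof.
rewrite /trap_ball /cball /= trap_mdistE /trap_dist /=.
rewrite (level_expl b1 (lt_center L b1 i S)); case: (i \in S) => /=.
  by rewrite addr0; split.
by rewrite gerDl ler10.
Qed.

(** The larger rank fixes the level between two centers, so a smaller [set_rank S'] gives exactly
    the radius and a larger one exceeds it. *)
Lemma trap_ball_inr S S' :
  trap_ball S (inr S') <-> (set_rank S' <= set_rank S)%N.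
Proof.
rewrite /trap_ball /cball /= trap_mdistE.
have [->|neq] := eqVneq S S'.
  by rewrite trap_distxx leqnn exprn_ge0// ltW// (g_gt0 g1).
have nX : (inr S : X) != inr S' by apply: contra neq => /eqP[->].
have nr : set_rank S != set_rank S' by rewrite (inj_eq (@set_rank_inj _)).
rewrite /trap_dist (negPf nX) /= addr0 (ler_gX g1).
case: (ltngtP (set_rank S) (set_rank S')) nr => // lt _.
  rewrite (level_sym b1) level_expl ?ltn_exp2l ?ltn_add2l//.
  by rewrite ltnS leq_add2l leqNgt lt.
by rewrite level_expl ?ltn_exp2l ?ltn_add2l.
Qed.

Lemma trap_ball_sub S S' : S \subset S' -> trap_ball S `<=` trap_ball S'.
Proof.
move=> sub [i|S''] /=.
  by move=> /trap_ball_inl iS; apply/trap_ball_inl; exact: (fintype.subsetP sub) _ iS.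
move=> /trap_ball_inr le; apply/trap_ball_inr.
exact: leq_trans le (set_rank_mono sub).
Qed.

Definition kill x S : {set Y} := if x is inl i then S :\ i else S.

Context (A : algorithm X) (i0 : Y).

(* The first [t] requests against A, and the points of the tree that A has not
   visited during them. *)
Fixpoint hunt (t : nat) : seq (set X) * {set Y} :=
  if t is u.+1 then
    let s := rcons (hunt u).1 (trap_ball (hunt u).2) in
    (s, kill (A (inl i0) s) (hunt u).2)
  else ([::], kill (inl i0) [set: Y]%SET).

Definition hunted (t : nat) : X :=
  if t is 0 then inl i0 else A (inl i0) (hunt t).1.

Lemma size_hunt t : size (hunt t).1 = t.
Proof. by elim: t => //= t IH; rewrite size_rcons IH. Qed.

Lemma take_hunt t n : (t <= n)%N -> take t (hunt n).1 = (hunt t).1.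
Proof.
elim: n => [|n IH]; first by rewrite leqn0 => /eqP ->.
rewrite leq_eqVlt => /predU1P[->|tn]; first by rewrite take_oversize ?size_hunt.
by rewrite /= -cats1 takel_cat ?size_hunt// IH.
Qed.

Lemma nth_hunt t n : (t < n)%N -> nth setT (hunt n).1 t = trap_ball (hunt t).2.
Proof.
elim: n => // n IH; rewrite ltnS leq_eqVlt /= nth_rcons size_hunt.
by move=> /predU1P[->|tn]; [rewrite ltnn eqxx | rewrite tn IH].
Qed.

Lemma kill_sub x S : kill x S \subset S.
Proof. by case: x => [i|S'] //=; rewrite subD1set. Qed.

Lemma hunt_sub t n : (t <= n)%N -> (hunt n).2 \subset (hunt t).2.
Proof.
move=> /subnKC <-; elim: (n - t)%N => [|m IH]; first by rewrite addn0.
by rewrite addnS /= (fintype.subset_trans (kill_sub _ _)).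
Qed.

(** Each request kills at most one leaf, and the starting leaf is dead from the outset, whence
    [t.+1]. *)
Lemma card_hunt t : (b ^ D - t.+1 <= #|(hunt t).2|)%N.
Proof.
have kill_card x S : (#|S| - 1 <= #|kill x S|)%N.
  case: x => [i|?] /=; last by rewrite leq_subr.
  by rewrite [X in (X - _)%N](cardsD1 i); case: (i \in S); rewrite ?addKn ?leq_subr.
elim: t => [|t IH].
  by have := kill_card (inl i0) [set: Y]%SET; rewrite cardsT card_ord.
by rewrite (leq_trans _ (kill_card _ _))// -addn1 subnDA leq_sub2r.
Qed.

Lemma hunt_nested n : nested_requests (hunt n).1.
Proof.
split=> t; rewrite size_hunt => tn; rewrite nth_hunt//.
  exists (inr (hunt t).2), (g ^+ (D + L + set_rank (hunt t).2).+1).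
  by rewrite exprn_ge0// ltW// (g_gt0 g1).
by rewrite nth_hunt 1?ltnW//; apply: trap_ball_sub; exact: hunt_sub.
Qed.

Lemma trajectory_hunt n t : (t <= n)%N ->
  trajectory A (inl i0) (hunt n).1 t = hunted t.
Proof. by case: t => // t tn; rewrite /trajectory take_hunt. Qed.

Lemma kill_hunted t i : hunted t = inl i -> i \notin (hunt t).2.
Proof. by case: t => [[<-]|t /= ->]; rewrite /= !inE eqxx. Qed.

Lemma online_cost_hunt n : feasible (@nested_requests R X) A ->
  Num.min (g ^+ L) n%:R <= online_cost A (inl i0) (hunt n).1.
Proof.
move=> feasA.
have -> : online_cost A (inl i0) (hunt n).1 = move_cost hunted n.
  rewrite /online_cost /move_cost size_hunt; apply: eq_bigr => t _.
  by rewrite !trajectory_hunt// ltnW.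
(* Invariant: either the toll [g ^+ L] for leaving the tree is paid, or the player sits on a leaf,
   which the next request excludes, and has paid at least 1 per request. *)
suff : g ^+ L <= move_cost hunted n \/
    ~~ is_center (hunted n) /\ n%:R <= move_cost hunted n.
  by rewrite ge_min => -[->//|[_ ->]]; rewrite orbT.
elim: n => [|n IH]; first by right; rewrite /move_cost big_ord0.
have -> : move_cost hunted n.+1 =
    move_cost hunted n + mdist (hunted n.+1) (hunted n).
  by rewrite /move_cost big_ord_recr.
case: IH => [le|[tree le]].
  by left; rewrite (le_trans le)// lerDl mdist_ge0.
have cost0 : 0 <= move_cost hunted n by apply: sumr_ge0 => t _; exact: mdist_ge0.
have in_ball : trap_ball (hunt n).2 (hunted n.+1).
  by apply: feasA; exact: (hunt_nested n.+1).
have [i hi] : exists i, hunted n = inl i.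
  by case: (hunted n) tree => // i _; exists i.
have := kill_hunted hi; rewrite hi; case: (hunted n.+1) in_ball => [j|S].
  move=> /trap_ball_inl jS iS; right; split=> //.
  rewrite mulrS addrC lerD//.
  have ji : (inl j : X) != inl i by apply: contraNneq iS => -[<-].
  exact: le_trans (gX_ge1 g1 _) (trap_dist_ge ji).
move=> _ _; left.
apply: (@le_trans _ _ (mdist (inr S : X) (inl i))); last by rewrite lerDr.
apply: (le_trans _ (trap_dist_ge _)) => //.
rewrite (ler_gX g1) /= (level_expl b1 (lt_center L b1 i S)) ltnW// ltnS.
by rewrite (leq_trans (leq_addl D L))// leq_addr.
Qed.

(** Survivors decrease, so [i] lies in every request: one move to [i] inside the tree, then rest. *)
Lemma offline_opt_hunt n i : i \in (hunt n).2 ->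
  0 <= offline_opt (inl i0 : X) (hunt n.+1).1 <= g ^+ D.
Proof.
move=> iS; rewrite /offline_opt; set E := (X in inf X).
pose y t : X := if t is 0%N then inl i0 else inl i.
have Ey : E (move_cost y n.+1).
  exists y; split=> // [t|]; last by rewrite size_hunt.
  rewrite size_hunt ltnS => tn; rewrite nth_hunt//=; apply/trap_ball_inl.
  exact: fintype.subsetP (hunt_sub tn) _ iS.
have E0 : lbound E 0.
  by move=> _ [z [_ _ ->]]; apply: sumr_ge0 => t _; exact: mdist_ge0.
apply/andP; split; first by apply: lb_le_inf => //; exists (move_cost y n.+1).
apply: (@le_trans _ _ (move_cost y n.+1)); first by apply: ge_inf => //; exists 0.
rewrite /move_cost big_ord_recl big1 => [|t _]; last by rewrite /= mdistxx.
rewrite addr0 /= trap_mdistE /trap_dist; case: ifP => _.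
  by rewrite exprn_ge0// ltW// (g_gt0 g1).
by rewrite addr0 (ler_gX g1) (level_small b1 (ltn_ord _) (ltn_ord _)).
Qed.

End Trapping.

Lemma trap_nested_ratio_ge {R : realType} (g N : R) (b D L : nat)
    (g1 : 1 < g) (b1 : (1 < b)%N) :
  0 < N -> N * g ^+ D <= g ^+ L -> N * g ^+ D + 1 <= b%:R ^+ D ->
  (N%:E <= nested_chasing_ratio (trap D L g1 b1))%E.
Proof.
move=> N0 NL Nb; have gD : 0 < g ^+ D by rewrite exprn_gt0// (g_gt0 g1).
have : (2 <= b ^ D)%N.
  rewrite -(ltr_nat R) natrX (lt_le_trans _ Nb)// ltrDr mulr_gt0//.
(* With [n.+2] leaves, one survives [n] requests, so [n.+1] requests can be posed, and [n.+1] is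
   [b ^ D - 1]. *)
case def_n: (b ^ D)%N => [|[|n]] // _.
have bD0 : (0 < b ^ D)%N by rewrite def_n.
apply: le_ereal_inf_tmp => _ [A feasA <-].
pose i0 := Ordinal bD0.
have /card_gt0P[i iS] : (0 < #|(hunt A i0 n).2|)%N.
  by rewrite (leq_trans _ (card_hunt A i0 n))// def_n subSS subSnn.
apply: le_ereal_sup_tmp; eexists; first by exists (inl i0), (hunt A i0 n.+1).1;
  split; [exact: hunt_nested | reflexivity].
apply: (@le_cost_ratio _ _ (g ^+ D)) => //; first exact: offline_opt_hunt iS.
apply: le_trans (online_cost_hunt i0 n.+1 feasA); rewrite le_min NL/=.
by rewrite -(lerD2r 1) (le_trans Nb)// -natrX def_n natr1.
Qed.

(** * Choice of the parameters *)

Lemma exists_expr_ge {R : archiRealFieldType} (q x : R) :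
  1 < q -> exists n, x <= q ^+ n.
Proof.
move=> q1; have q10 : 0 < q - 1 by rewrite subr_gt0.
have bernoulli n : n%:R * (q - 1) <= q ^+ n.
  elim: n => [|n IH]; first by rewrite mul0r expr0.
  have -> : q ^+ n.+1 = (q - 1) * q ^+ n + q ^+ n by rewrite exprS; ring.
  rewrite mulrS mulrDl mul1r lerD// ler_peMr ?(ltW q10)//.
  by rewrite exprn_ege1// ltW.
exists (Num.truncn (x / (q - 1))).+1; apply: le_trans (bernoulli _).
by rewrite -ler_pdivrMr// ltW// truncnS_gt.
Qed.

Unset Implicit Arguments.

Theorem theorem1p4 (R : realType) (g : R) (hg : 1 < g) :
  exists c C : R, [/\ 0 < c, 0 < C &
    forall rho N : R, 0 < rho -> 0 < N ->
      exists X : metricType R,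
        [/\ ((c * rho)%:E <= cover_dim X g)%E,
            (cover_dim X g <= (C * Num.max 1 rho)%:E)%E,
            (N%:E <= nested_chasing_ratio X)%E
          & (nested_chasing_ratio X <= chasing_ratio X)%E]].
Proof.
have g0 : 0 < g by exact: lt_trans hg.
have lg : 0 < ln g by rewrite ln_gt0.
have l4 : 0 < ln 4 :> R by rewrite ln_gt0 ?ltr1n.
(* [C] comes from log_g (2b) <= m + log_g 4 <= (1 + log_g 4) m, where m = max(1, rho). *)
exists 1, (1 + ln 4 / ln g); split=> //; first by rewrite addr_gt0 ?divr_gt0.
move=> rho N rho0 N0; set m := Num.max 1 rho.
have m1 : 1 <= m by rewrite le_max lexx.
have rhom : rho <= m by rewrite le_max lexx orbT.
have gm1 : 1 <= g `^ m.
  by rewrite (le_trans (ltW hg))// -{1}(powRr1 (ltW g0)) ler_powR// ltW.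
(* The least natural number above g^m: [rho <= m] serves the lower dimension bound, [1 <= m] ensures
   [g < b]. *)
pose b := (Num.truncn (g `^ m)).+1.
have gmb : g `^ m < b%:R by rewrite truncnS_gt.
have bgm : (b * 2)%:R <= 4 * g `^ m.
  have : (Num.truncn (g `^ m))%:R <= g `^ m by rewrite truncn_le// powR_ge0.
  by rewrite natrM -[b%:R]natr1; lra.
have gb : g < b%:R.
  by rewrite (le_lt_trans _ gmb)// -{1}(powRr1 (ltW g0)) ler_powR// ltW.
have b1 : (1 < b)%N by rewrite -(ltr_nat R) (lt_trans hg).
have b0 : 0 < b%:R :> R by rewrite ltr0n.
(* The 1 in [N + 1] pays for the starting leaf, since [1 <= g ^+ D]. *)
have [D0 hD] : exists D, N + 1 <= (b%:R / g) ^+ D.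
  by apply: exists_expr_ge; rewrite ltr_pdivlMr ?mul1r.
pose D := D0.+1.
have ND : N * g ^+ D + 1 <= b%:R ^+ D.
  have gD1 : 1 <= g ^+ D by rewrite exprn_ege1// ltW.
  apply: (@le_trans _ _ ((N + 1) * g ^+ D)); first by rewrite mulrDl mul1r lerD2l.
  rewrite -ler_pdivlMr ?exprn_gt0// -expr_div_n (le_trans hD)//.
  by rewrite ler_weXn2l// ler_pdivlMr// mul1r ltW.
have [L NL] : exists L, N * g ^+ D <= g ^+ L by exact: exists_expr_ge.
exists (trap D L hg b1).
have /andP[lb ub] := @trap_cover_dim_bounds R g b D L hg b1 isT.
split.
- apply: le_trans lb; rewrite lee_fin mul1r ler_pdivlMr//.
  rewrite (le_trans (ler_wpM2r (ltW lg) rhom))// -ln_powR ler_ln ?posrE//.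
    exact: ltW.
  exact: powR_gt0.
- apply: (le_trans ub); rewrite lee_fin ler_pdivrMr//.
  have -> : (1 + ln 4 / ln g) * m * ln g = m * ln g + m * ln 4.
    by field; rewrite gt_eqF.
  apply: (@le_trans _ _ (ln (4 * g `^ m))).
    by rewrite ler_ln ?posrE// ?mulr_gt0 ?ltr0n ?powR_gt0.
  rewrite lnM ?posrE ?powR_gt0// ln_powR addrC lerD2l.
  by rewrite ler_peMl// ltW.
- exact: trap_nested_ratio_ge.
- exact: nested_le_chasing.
Qed.
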